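(* Fix $\varepsilon\in(0,1)$. For $\kappa>0$ let $a=(1-\varepsilon)\kappa$, $b=(1+\varepsilon)\kappa$, let $c^*=c^*(\kappa,\varepsilon)>0$ be the unique positive solution of $$e^{-b^2/2}\cosh(bc^* )=e^{-a^2/2}\cosh(ac^* ),$$ and let $$R_\infty^*(\kappa,\varepsilon)=\inf_\phi\Big\{\sup_{|\mu|\le a}E_\mu\phi(Y)+\sup_{|\mu|\ge b}E_\mu\{1-\phi(Y)\}\Big\},$$ where $Y\sim N(\mu,1)$ under $E_\mu$ and the infimum is over measurable $\phi:\mathbb R\to[0,1]$. Then, as $\kappa\downarrow0$, $$c^*=1+\frac{1+\varepsilon^2}{6}\kappa^2+O(\kappa^4)$$ and $$R_\infty^*(\kappa,\varepsilon)=1-4\varepsilon\varphi(1)\kappa^2+O(\kappa^4).$$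
   Context: $\varphi$ is the standard normal density. Existence and uniqueness of the positive solution $c^*$ hold for every $\kappa>0$ and $\varepsilon\in(0,1)$, and the minimax value $R_\infty^*(\kappa,\varepsilon)$ is attained by the rule $\mathbf 1\{|Y|>c^*\}$. *)

(* Defs.v *)
From HB Require Import structures.
From mathcomp Require Export all_boot all_order all_algebra.
From mathcomp Require Export all_classical all_reals all_analysis.
Export Order.TTheory GRing.Theory Num.Theory.
Export numFieldNormedType.Exports.

Local Open Scope classical_set_scope.
Local Open Scope ring_scope.

Definition cosh {R : realType} (x : R) : R := (expR x + expR (- x)) / 2.

Definition lower_radius {R : realType} (kappa eps : R) : R := (1 - eps) * kappa.
Definition upper_radius {R : realType} (kappa eps : R) : R := (1 + eps) * kappa.

Definition cstar_equation {R : realType} (kappa eps c : R) : Prop :=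
  let a := lower_radius kappa eps in
  let b := upper_radius kappa eps in
  expR (- (b ^+ 2 / 2)) * cosh (b * c) = expR (- (a ^+ 2 / 2)) * cosh (a * c).

(* Definite description: [unique P c] says that [c] satisfies [P] and that no
   other point does. The default value 0 is returned only when the positive
   solution fails to exist or to be unique. *)
Definition cstar {R : realType} (kappa eps : R) : R :=
  xget 0 [set c | unique (fun t : R => 0 < t /\ cstar_equation kappa eps t) c].

Definition randomized_test {R : realType} (phi : R -> R) : Prop :=
  measurable_fun [set: R] phi /\ forall y, 0 <= phi y <= 1.

(* The expectation is taken on the canonical space: Y is the identity of R,
   distributed as N(mu, 1). *)
Definition sum_of_errors {R : realType} (kappa eps : R) (phi : R -> R)
    : \bar R :=
  (ereal_sup [set 'E_(normal_prob mu 1)[phi] | mu in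
     [set mu : R | `|mu| <= lower_radius kappa eps]%R]
   + ereal_sup [set 'E_(normal_prob mu 1)[(fun y : R => 1 - phi y)%R] | mu in
     [set mu : R | upper_radius kappa eps <= `|mu|]%R])%E.

Definition minimax_risk {R : realType} (kappa eps : R) : \bar R :=
  ereal_inf [set sum_of_errors kappa eps phi | phi in @randomized_test R].

(* Main.v *)
Require Import Defs.
From mathcomp Require Import measurable_realfun ring lra.

Local Open Scope classical_set_scope.
Local Open Scope ring_scope.

(* Let q(m, y) = exp(- m^2/2) cosh(m y). Then
   q(m, y) = 1 + m^2 (y^2 - 1)/2 + m^4 (y^4 - 6 y^2 + 3)/24 + O(m^6 e^(2|y|)).
   The equation for c* is q(b, c) = q(a, c); the expansion gives the sign of
   q(b, c) - q(a, c) at c = 1 + (1 + eps^2)/6 kappa^2 +- M kappa^4, so there is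
   a solution in between, and it is the only one because cosh(b c)/cosh(a c) is
   increasing.

   The risk expansion does not go through c*. For the upper bound, use the test
   1{|Y| >= 1}; its rejection probability is monotone in |mu|, so its risk is
   1 - int_{|y| >= 1} phi (q(b, .) - q(a, .)). For the lower bound, put the
   two-point priors +-a and +-b on the hypotheses: the risk of any test is at
   least 1 - int phi (q(b, .) - q(a, .))^+. In both cases q(b, y) - q(a, y) is
   2 eps kappa^2 (y^2 - 1) up to O(kappa^4 cosh(2 y)), which is integrable
   against phi, and int_{|y| >= 1} (y^2 - 1) phi = 2 phi(1). *)

(** * Taylor remainder and growth of the exponential *)

(** Since the binomial coefficient of [k + n] over [n] is at least 1, [(k + n)!] is at least
    [k! n!]. The tail from index [n] is thus bounded term by term by [|x|^n / n!] times the series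
    of [expR |x|]. *)
Lemma expR_taylor_le (R : realType) (n : nat) (x : R) :
  `|expR x - \sum_(k < n) x ^+ k / k`!%:R| <= `|x| ^+ n / n`!%:R * expR `|x|.
Proof.
have cv (y : R) : series (exp_coeff y) @ \oo --> expR y.
  exact: is_cvg_series_exp_coeff.
have partial_le N (y : R) : 0 <= y -> series (exp_coeff y) N <= expR y.
  move=> y0; apply: nondecreasing_cvgn_le; last exact: is_cvg_series_exp_coeff.
  apply/nondecreasing_seqP => k; rewrite -subr_ge0 seriesSB.
  by rewrite divr_ge0 // exprn_ge0.
have term_le k : `|x ^+ (k + n) / (k + n)`!%:R| <=
    `|x| ^+ n / n`!%:R * (`|x| ^+ k / k`!%:R).
  rewrite normrM normrX normrV ?unitfE ?pnatr_eq0 -?lt0n ?fact_gt0 //.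
  rewrite normr_nat [leRHS]mulrACA -exprD addnC ler_wpM2l ?exprn_ge0 //.
  rewrite -invfM addnC lef_pV2 ?posrE ?mulr_gt0 ?ltr0n ?fact_gt0 // -natrM ler_nat.
  rewrite -(@bin_fact (k + n) n) ?leq_addl // addnK.
  by rewrite leq_pmull // bin_gt0 leq_addl.
have tail_le N : `|series (exp_coeff x) (N + n)%N - \sum_(k < n) x ^+ k / k`!%:R|
    <= `|x| ^+ n / n`!%:R * expR `|x|.
  have -> : \sum_(k < n) x ^+ k / k`!%:R = series (exp_coeff x) n.
    by rewrite /series /= big_mkord.
  rewrite sub_series_geq ?leq_addl // -{1}[n]add0n big_addn addnK.
  apply: le_trans (ler_norm_sum _ _ _) _.
  apply: (@le_trans _ _ (`|x| ^+ n / n`!%:R * series (exp_coeff `|x|) N)).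
    by rewrite /series /= mulr_sumr; apply: ler_sum => k _; exact: term_le.
  by rewrite ler_wpM2l ?partial_le // mulr_ge0 // exprn_ge0.
have cvN : series (exp_coeff x) (N + n)%N @[N --> \oo] --> expR x.
  by have := cv x; rewrite -(cvg_shiftn n).
have h : `|series (exp_coeff x) (N + n)%N - \sum_(k < n) x ^+ k / k`!%:R|
    @[N --> \oo] --> `|expR x - \sum_(k < n) x ^+ k / k`!%:R|.
  by apply: cvg_norm; apply: cvgB => //; exact: cvg_cst.
rewrite -(cvg_lim _ h) //; apply: limr_le; first exact: (cvgP _ h).
by near=> N; exact: tail_le.
Unshelve. all: by end_near. Qed.

Lemma exprn_le_expR (R : realType) (n : nat) (x : R) :
  `|x| ^+ n / n`!%:R <= expR `|x|.
Proof.
case: n => [|n]; last by apply: le_trans (expR_ge1Dxn n (normr_ge0 x)); rewrite lerDr.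
by rewrite expr0 fact0 divr1 -expR0 ler_expR.
Qed.

(** * Comparison and Taylor bounds for the hyperbolic cosine *)

Section cosh.
Variable R : realType.
Implicit Types x y a b c d : R.

Lemma coshN x : cosh (- x) = cosh x.
Proof. by rewrite /cosh opprK addrC. Qed.

Lemma continuous_cosh : continuous (@cosh R).
Proof.
move=> x; apply: cvgM; last exact: cvg_cst.
apply: cvgD; first exact: continuous_expR.
apply: (continuous_comp (f := -%R)); last exact: continuous_expR.
exact: opp_continuous.
Qed.

Lemma cosh_norm x : cosh `|x| = cosh x.
Proof. by case: ger0P => // _; rewrite coshN. Qed.

Lemma cosh_gt0 x : 0 < cosh x.
Proof. by rewrite divr_gt0 // addr_gt0 // expR_gt0. Qed.

Lemma cosh_le_expR_norm x : cosh x <= expR `|x|.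
Proof.
rewrite -cosh_norm /cosh ler_pdivrMr // mulr_natr mulr2n lerD2l ler_expR.
by rewrite -subr_ge0 opprK addr_ge0.
Qed.

Lemma expR_norm_le_cosh x : expR `|x| <= 2 * cosh x.
Proof.
rewrite -cosh_norm /cosh mulrCA divff ?pnatr_eq0 // mulr1.
by rewrite lerDl expR_ge0.
Qed.

Lemma cosh_mulD x y : 2 * (cosh x * cosh y) = cosh (x + y) + cosh (x - y).
Proof. by rewrite /cosh opprD opprB !expRD; field. Qed.

Lemma ltr_cosh x y : `|x| < y -> cosh x < cosh y.
Proof.
move=> xy; have y0 : 0 < y by apply: le_lt_trans xy.
have XY : expR `|x| < expR y by rewrite ltr_expR.
have XY1 : 1 < expR `|x| * expR y by rewrite -expRD expR_gt1 ltr_wpDl.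
have X0 := expR_gt0 `|x|; have Y0 := expR_gt0 y.
rewrite -cosh_norm -subr_gt0 /cosh !expRN.
have -> : (expR y + (expR y)^-1) / 2 - (expR `|x| + (expR `|x|)^-1) / 2 =
    (expR y - expR `|x|) * (expR `|x| * expR y - 1) / (2 * (expR `|x| * expR y)).
  by field; rewrite !gt_eqF.
by rewrite divr_gt0 ?mulr_gt0 // subr_gt0.
Qed.

(* The product formula turns the comparison of the two products into a
   termwise comparison of sums of two cosh's. *)
Lemma cosh_ratio_lt a b c d : 0 <= a < b -> 0 <= c < d ->
  cosh (b * c) * cosh (a * d) < cosh (b * d) * cosh (a * c).
Proof.
move=> /andP[a0 ab] /andP[c0 cd].
rewrite -(@ltr_pM2l _ 2) // !cosh_mulD.
by apply: ltrD; apply: ltr_cosh; rewrite ltr_norml; apply/andP; split; nra.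
Qed.

(** Weak form of the preceding lemma, with signs removed by evenness and the cases of equality
    treated apart. It is the monotonicity of the likelihood ratio in the modulus of the
    observation. *)
Lemma cosh_ratio_le a b c d : `|a| <= b -> `|c| <= `|d| ->
  cosh (b * c) * cosh (a * d) <= cosh (b * d) * cosh (a * c).
Proof.
move=> ab cd; have b0 : 0 <= b by apply: le_trans ab.
have cosh_normM x y : cosh (x * y) = cosh (`|x| * `|y|).
  by rewrite -normrM cosh_norm.
rewrite !(cosh_normM _ c) !(cosh_normM _ d) (ger0_norm b0).
have [->|ab'] := eqVneq `|a| b; first by rewrite mulrC.
have [->|cd'] := eqVneq `|c| `|d|; first by [].
by rewrite ltW // cosh_ratio_lt // normr_ge0 lt_neqAle ?ab' ?cd'.
Qed.

(** Averaging the sixth-order bounds for [expR] at [x] and [- x] cancels the odd terms. *)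
Lemma cosh_taylor x :
  `|cosh x - (1 + x ^+ 2 / 2 + x ^+ 4 / 24)| <= `|x| ^+ 6 / 720 * expR `|x|.
Proof.
have := expR_taylor_le R 6 x; have := expR_taylor_le R 6 (- x).
have f2 : 2`! = 2%N by []. have f3 : 3`! = 6%N by [].
have f4 : 4`! = 24%N by []. have f5 : 5`! = 120%N by [].
have f6 : 6`! = 720%N by [].
rewrite !normrN !big_ord_recr !big_ord0 /= fact0 f2 f3 f4 f5 f6.
rewrite !ler_norml /cosh => /andP[h1 h2] /andP[h3 h4].
by apply/andP; split; lra.
Qed.

End cosh.

(* The density of the equal mixture of N(m, 1) and N(-m, 1) with respect to
   N(0, 1). *)
Definition mix_ratio {R : realType} (m y : R) : R :=
  expR (- (m ^+ 2 / 2)) * cosh (m * y).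

(** * Expansion of the mixture likelihood ratio for small [m], and its domination property *)

Section mix_ratio.
Variable R : realType.
Implicit Types m y a b c : R.

Lemma mix_ratio_gt0 m y : 0 < mix_ratio m y.
Proof. by rewrite mulr_gt0 ?expR_gt0 ?cosh_gt0. Qed.

Lemma continuous_mix_ratio m : continuous (mix_ratio m).
Proof.
move=> y; apply: cvgM; first exact: cvg_cst.
apply: (continuous_comp (f := *%R m)); last exact: continuous_cosh.
exact: mulrl_continuous.
Qed.

Lemma mix_ratioNr m y : mix_ratio m (- y) = mix_ratio m y.
Proof. by rewrite /mix_ratio mulrN coshN. Qed.

Lemma mix_ratioNl m y : mix_ratio (- m) y = mix_ratio m y.
Proof. by rewrite /mix_ratio mulNr coshN sqrrN. Qed.

(** The coefficients of [m^2 / 2] and [m^4 / 24] are the Hermite polynomials of degree 2 and 4.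
    Powers of [y] in the remainder are absorbed into one factor [expR |y|]; the second factor bounds
    [expR |m * y|]. *)
Lemma mix_ratio_taylor6 m y : `|m| <= 1 ->
  `|mix_ratio m y - (1 + m ^+ 2 / 2 * (y ^+ 2 - 1)
                       + m ^+ 4 / 24 * (y ^+ 4 - 6 * y ^+ 2 + 3))|
  <= 2 * m ^+ 6 * expR (2 * `|y|).
Proof.
move=> m1; rewrite /mix_ratio.
have m20 : 0 <= m ^+ 2 by exact: sqr_ge0.
have m21 : m ^+ 2 <= 1.
  by rewrite -[m ^+ 2]ger0_norm // normrX exprn_ile1.
have hm6 : 0 <= m ^+ 6 by rewrite (exprM m 2 3) exprn_ge0.
have ee : expR (2 * `|y|) = expR `|y| * expR `|y|.
  by rewrite -expRD mulr_natl mulr2n.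
have e1 : 1 <= expR `|y| by rewrite -expR0 ler_expR.
have y2e : y ^+ 2 <= 2 * expR `|y|.
  have := exprn_le_expR R 2 y; rewrite -normrX (ger0_norm (sqr_ge0 _)).
  by rewrite ler_pdivrMr // (_ : 2`! = 2)%N // mulrC.
have y4e : y ^+ 4 <= 24 * expR `|y|.
  have := exprn_le_expR R 4 y; rewrite -normrX ger0_norm.
    by rewrite ler_pdivrMr // (_ : 4`! = 24)%N // mulrC.
  by rewrite (exprM y 2 2) sqr_ge0.
have y6e : `|y| ^+ 6 / 720 <= expR `|y| by exact: (exprn_le_expR R 6 y).
have mye : expR `|m * y| <= expR `|y|.
  by rewrite ler_expR normrM ler_piMl.
have hC := le_trans (cosh_le_expR_norm _ (m * y)) mye.
have hC0 := cosh_gt0 _ (m * y).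
have hCT : `|cosh (m * y) - (1 + (m * y) ^+ 2 / 2 + (m * y) ^+ 4 / 24)| <=
    m ^+ 6 * expR (2 * `|y|).
  apply: le_trans (cosh_taylor _ _) _.
  have -> : `|m * y| ^+ 6 / 720 = m ^+ 6 * (`|y| ^+ 6 / 720).
    by rewrite {1}normrM exprMn -(normrX 6 m) (ger0_norm hm6) -mulrA.
  rewrite ee -[leLHS]mulrA; apply: (ler_wpM2l hm6).
  apply: ler_pM; [|exact: expR_ge0|exact: y6e|exact: mye].
  exact: (divr_ge0 (exprn_ge0 _ (normr_ge0 _)) (ler0n _ _)).
have hAT : `|expR (- (m ^+ 2 / 2)) - (1 - m ^+ 2 / 2 + (m ^+ 2 / 2) ^+ 2 / 2)|
    <= m ^+ 6 / 24.
  have t0 : 0 <= m ^+ 2 / 2 by rewrite divr_ge0.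
  have := expR_taylor_le R 3 (- (m ^+ 2 / 2)).
  rewrite normrN (ger0_norm t0) !big_ord_recr big_ord0 /= fact0 expr0 expr1 !divr1.
  rewrite (_ : 2`! = 2)%N // (_ : 3`! = 6)%N //.
  rewrite (_ : 0 + _ + _ + _ = 1 - m ^+ 2 / 2 + (m ^+ 2 / 2) ^+ 2 / 2); last first.
    by field.
  move=> /le_trans; apply.
  (* With [t = m^2 / 2 <= 1/2], [expR (- t) >= 1 - t >= 1/2]. *)
  have et2 : expR (m ^+ 2 / 2) <= 2.
    have := expR_ge1Dx (- (m ^+ 2 / 2)); have := expR_gt0 (m ^+ 2 / 2).
    have := expRxMexpNx_1 (m ^+ 2 / 2).
    set u := expR (_ / _); set v := expR (- _) => uv u0 hv; nra.
  have -> : m ^+ 6 / 24 = (m ^+ 2 / 2) ^+ 3 / 6 * 2 by field.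
  by rewrite ler_wpM2l // divr_ge0 // exprn_ge0.
move: hAT hCT hC hC0 y2e y4e e1; rewrite ee.
move: (expR (- _)) (cosh _) (expR `|y|) => A C e hA hC Ce C0 y2e y4e e1.
have y20 := sqr_ge0 y.
(* Three sources of error: the remainder of the exponential, the remainder of the cosine, and the
   terms of degree 6 and 8 in [m] in the product of the two Taylor polynomials. *)
have -> : A * C - (1 + m ^+ 2 / 2 * (y ^+ 2 - 1)
                     + m ^+ 4 / 24 * (y ^+ 4 - 6 * y ^+ 2 + 3)) =
  (A - (1 - m ^+ 2 / 2 + (m ^+ 2 / 2) ^+ 2 / 2)) * C +
  (1 - m ^+ 2 / 2 + (m ^+ 2 / 2) ^+ 2 / 2) *
    (C - (1 + (m * y) ^+ 2 / 2 + (m * y) ^+ 4 / 24)) +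
  m ^+ 6 * (- (y ^+ 4 / 48) + y ^+ 2 / 16 + m ^+ 2 * y ^+ 4 / 192).
  by field.
have y40 : 0 <= y ^+ 4 by rewrite (exprM y 2 2) sqr_ge0.
have h1 : `|(A - (1 - m ^+ 2 / 2 + (m ^+ 2 / 2) ^+ 2 / 2)) * C| <=
    m ^+ 6 / 24 * e.
  by rewrite normrM (gtr0_norm C0) ler_pM // ltW.
have h2 : `|(1 - m ^+ 2 / 2 + (m ^+ 2 / 2) ^+ 2 / 2) *
    (C - (1 + (m * y) ^+ 2 / 2 + (m * y) ^+ 4 / 24))| <= m ^+ 6 * (e * e).
  rewrite normrM -[leRHS]mul1r ler_pM //.
  by rewrite ler_norml; apply/andP; split; nra.
have h3 : `|m ^+ 6 * (- (y ^+ 4 / 48) + y ^+ 2 / 16 + m ^+ 2 * y ^+ 4 / 192)|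
    <= m ^+ 6 * (5 / 8 * e).
  rewrite normrM (ger0_norm hm6) ler_wpM2l // ler_norml.
  have : 0 <= m ^+ 2 * y ^+ 4 <= y ^+ 4 by rewrite mulr_ge0 // ler_piMl.
  by move=> /andP[? ?]; apply/andP; split; lra.
have eE : m ^+ 6 * e <= m ^+ 6 * (e * e).
  by rewrite ler_wpM2l // ler_peMl //; lra.
have m6e : 0 <= m ^+ 6 * e by rewrite mulr_ge0 //; lra.
apply: le_trans (ler_normD _ _) _.
have h12 := ler_normD ((A - (1 - m ^+ 2 / 2 + (m ^+ 2 / 2) ^+ 2 / 2)) * C)
  ((1 - m ^+ 2 / 2 + (m ^+ 2 / 2) ^+ 2 / 2) *
    (C - (1 + (m * y) ^+ 2 / 2 + (m * y) ^+ 4 / 24))).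
lra.
Qed.

(** The degree 4 term joins the remainder. The remainder carries [cosh (2 * y)] because this factor
    times the standard density is a multiple of the probability density [mix_pdf 2], so it
    integrates exactly. *)
Lemma mix_ratio_taylor4 m y : `|m| <= 1 ->
  `|mix_ratio m y - (1 + m ^+ 2 / 2 * (y ^+ 2 - 1))|
  <= 8 * m ^+ 4 * cosh (2 * y).
Proof.
move=> m1; have := mix_ratio_taylor6 m y m1.
have m40 : 0 <= m ^+ 4 by rewrite (exprM m 2 2) sqr_ge0.
have m6 : m ^+ 6 <= m ^+ 4.
  rewrite (exprD m 2 4) ler_piMl // -[m ^+ 2]ger0_norm ?sqr_ge0 //.
  by rewrite normrX exprn_ile1.
have := expR_norm_le_cosh _ (2 * y); rewrite normrM normr_nat.
have y40 : 0 <= y ^+ 4 by rewrite (exprM y 2 2) sqr_ge0.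
have y20 := sqr_ge0 y.
have y2e : y ^+ 2 <= expR (2 * `|y|) / 2.
  have := exprn_le_expR R 2 (2 * y).
  rewrite -normrX (ger0_norm (sqr_ge0 _)) exprMn normrM normr_nat.
  by rewrite (_ : 2`! = 2)%N //; lra.
have y4e : y ^+ 4 <= expR (2 * `|y|) * 3 / 2.
  have := exprn_le_expR R 4 (2 * y).
  rewrite -normrX exprMn ger0_norm; last by rewrite mulr_ge0 // exprn_ge0.
  by rewrite normrM normr_nat (_ : 4`! = 24)%N //; lra.
have e1 : 1 <= expR (2 * `|y|) by rewrite -expR0 ler_expR mulr_ge0.
move: (expR _) (cosh _) e1 y2e y4e => e c e1 y2e y4e ec.
rewrite !ler_norml => /andP[h1 h2].
have l1 : m ^+ 6 * e <= m ^+ 4 * e by rewrite ler_wpM2r //; lra.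
have l2 : m ^+ 4 * e <= m ^+ 4 * (2 * c) by rewrite ler_wpM2l.
have l3 : m ^+ 4 * (y ^+ 4 - 6 * y ^+ 2 + 3) <= m ^+ 4 * (24 * e).
  by rewrite ler_wpM2l //; lra.
have l4 : m ^+ 4 * - (24 * e) <= m ^+ 4 * (y ^+ 4 - 6 * y ^+ 2 + 3).
  by rewrite ler_wpM2l //; lra.
have m4e : 0 <= m ^+ 4 * e by rewrite mulr_ge0 //; lra.
by apply/andP; split; lra.
Qed.

(** The quotient of [mix_ratio a] by [mix_ratio m] is nondecreasing in the modulus of its argument,
    so once it reaches 1 it stays above. *)
Lemma mix_ratio_dominated a m c d : `|m| <= a -> `|c| <= `|d| ->
  mix_ratio m c <= mix_ratio a c -> mix_ratio m d <= mix_ratio a d.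
Proof.
move=> ma cd; rewrite /mix_ratio => h.
have ratio := cosh_ratio_le _ _ _ _ _ ma cd.
rewrite -(@ler_pM2r _ (cosh (a * c))) ?cosh_gt0 //.
have A0 := expR_gt0 (- (m ^+ 2 / 2)).
move: h A0; set A := expR _; set B := expR _ => h A0.
apply: (@le_trans _ _ (A * cosh (m * c) * cosh (a * d))).
  by rewrite -2!(mulrA A) ler_pM2l // [leLHS]mulrC [leRHS]mulrC.
by rewrite [leRHS]mulrAC ler_pM2r ?cosh_gt0.
Qed.

End mix_ratio.

(** * Uniqueness, existence and location of [cstar] *)

Section cstar_expansion.
Variables (R : realType) (eps : R).
Hypothesis heps : 0 < eps < 1.

(** If [c < d] both solved the equation, multiplying one equation by the other crosswise would give
    equality in [cosh_ratio_lt]. *)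
Lemma cstar_equation_inj (kappa c d : R) : 0 < kappa -> 0 < c -> 0 < d ->
  cstar_equation kappa eps c -> cstar_equation kappa eps d -> c = d.
Proof.
move=> k0; wlog cd : c d / c < d => [hwlog c0 d0 hc hd|c0 d0].
  by have [cd|cd|//] := ltgtP c d; [exact: hwlog|symmetry; exact: hwlog].
rewrite /cstar_equation /=.
set a := lower_radius kappa eps; set b := upper_radius kappa eps => hc hd.
have /andP[e0 e1] := heps.
have ab : 0 <= a < b.
  by rewrite /a /b /lower_radius /upper_radius; apply/andP; split; nra.
have := cosh_ratio_lt _ _ _ _ _ ab (introT andP (conj (ltW c0) cd)).
move: (expR_gt0 (- (a ^+ 2 / 2))) (expR_gt0 (- (b ^+ 2 / 2))) hc hd.
move: (expR (- (a ^+ 2 / 2))) (expR (- (b ^+ 2 / 2))) => A B A0 B0 hc hd.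
rewrite -(ltr_pM2l B0) -(ltr_pM2l A0) [ltLHS](_ : _ =
  (B * cosh (b * c)) * (A * cosh (a * d))); last by ring.
by rewrite hc -hd [ltRHS](_ : _ = (A * cosh (a * c)) * (B * cosh (b * d)))
  ?ltxx; last by ring.
Qed.

(** Exhibiting one positive solution identifies [cstar] and rules out its default value 0. *)
Lemma cstar_solution (kappa c : R) : 0 < kappa -> 0 < c ->
  cstar_equation kappa eps c -> cstar kappa eps = c.
Proof.
move=> k0 c0 hc; rewrite /cstar; apply: xget_unique.
  by split=> // d [d0 hd]; exact: (cstar_equation_inj kappa).
move=> d [[d0 hd] _]; exact: (cstar_equation_inj kappa).
Qed.

(** Here [b^2 - a^2 = 4 eps kappa^2] and [b^4 - a^4 = 8 eps (1 + eps^2) kappa^4]. The two remainders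
    contribute 128 and 2 times [expR 4 * kappa^6], and 256 rounds up the sum. *)
Lemma mix_ratio_diff_taylor (kappa c : R) : 0 < kappa <= 1 / 2 -> `|c| <= 2 ->
  `|mix_ratio (upper_radius kappa eps) c - mix_ratio (lower_radius kappa eps) c
    - 4 * eps * kappa ^+ 2 * ((c ^+ 2 - 1) / 2
        + (1 + eps ^+ 2) / 12 * kappa ^+ 2 * (c ^+ 4 - 6 * c ^+ 2 + 3))|
  <= 256 * expR 4 * kappa ^+ 6.
Proof.
move=> /andP[k0 k1] c2; have /andP[e0 e1] := heps.
rewrite /lower_radius /upper_radius.
have hb : `|(1 + eps) * kappa| <= 1 by rewrite ler_norml; apply/andP; split; nra.
have ha : `|(1 - eps) * kappa| <= 1 by rewrite ler_norml; apply/andP; split; nra.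
have := mix_ratio_taylor6 _ _ c hb; have := mix_ratio_taylor6 _ _ c ha.
have e64 : (1 + eps) ^+ 6 <= 64.
  by rewrite (_ : 64 = 2 ^+ 6 :> R) ?lerXn2r ?nnegrE //; [lra|lra|ring].
have e61 : (1 - eps) ^+ 6 <= 1 by apply: exprn_ile1; lra.
have ec : expR (2 * `|c|) <= expR 4 by rewrite ler_expR; lra.
have k60 : 0 <= kappa ^+ 6 by rewrite exprn_ge0 // ltW.
have E0 := expR_ge0 (2 * `|c|).
have hB : 2 * ((1 + eps) * kappa) ^+ 6 * expR (2 * `|c|) <=
    128 * kappa ^+ 6 * expR 4.
  rewrite exprMn; apply: ler_pM => //.
    by rewrite mulr_ge0 // mulr_ge0 // exprn_ge0; lra.
  by rewrite mulrA ler_wpM2r //; lra.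
have hA : 2 * ((1 - eps) * kappa) ^+ 6 * expR (2 * `|c|) <=
    2 * kappa ^+ 6 * expR 4.
  rewrite exprMn; apply: ler_pM => //.
    by rewrite mulr_ge0 // mulr_ge0 // exprn_ge0; lra.
  by rewrite mulrA ler_wpM2r //; lra.
have kE : 0 <= kappa ^+ 6 * expR 4 by rewrite mulr_ge0 ?expR_ge0.
move=> /le_trans - /(_ _ hA) ta /le_trans - /(_ _ hB) tb; move: ta tb.
rewrite !ler_norml => /andP[a1 a2] /andP[b1 b2].
by apply/andP; split; lra.
Qed.

(* At [c = 1 + s k + t M k^2], with [k = kappa^2] and [s = (1 + eps^2) / 6],
   the bracket of [mix_ratio_diff_taylor] is [t M k^2 + O(k^2)], so its sign
   is that of [t = +-1] once [M] is large. *)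
Lemma cstar_equation_bracket (k s t M : R) :
  0 < k <= 1 -> 0 <= s <= 1 / 3 -> `|t| <= 1 -> 0 <= M -> M * k <= 1 / 2 ->
  let c := 1 + s * k + t * M * k ^+ 2 in
  `|c| <= 2 /\
  `|(c ^+ 2 - 1) / 2 + s / 2 * k * (c ^+ 4 - 6 * c ^+ 2 + 3) - t * M * k ^+ 2|
    <= 3 * k ^+ 2.
Proof.
move=> /andP[k0 k1] /andP[s0 s1] t1 M0 Mk.
pose d := s * k + t * M * k ^+ 2.
have dk : `|d| <= k.
  rewrite /d; apply: le_trans (ler_normD _ _) _.
  have h1 : `|s * k| <= k / 3 by rewrite ger0_norm; nra.
  have h2 : `|t * M * k ^+ 2| <= k / 2.
    have -> : t * M * k ^+ 2 = t * (M * k * k) by ring.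
    have h : 0 <= M * k * k <= k / 2 by apply/andP; split; nra.
    move: h => /andP[h0 h1']; rewrite normrM (ger0_norm h0).
    by apply: le_trans h1'; rewrite ler_piMl.
  lra.
have d2 : `|d ^+ 2| <= k ^+ 2 by rewrite normrX lerXn2r ?nnegrE ?normr_ge0 ?(ltW k0).
have d1 : `|d| <= 1 by apply: le_trans k1.
have dd n : `|d ^+ n.+1| <= k.
  by rewrite exprS normrM normrX -[leRHS]mulr1 ler_pM // exprn_ile1.
move=> c; have -> : c = 1 + d by rewrite /c /d addrA.
split.
  by move: d1; rewrite !ler_norml => /andP[? ?]; apply/andP; split; lra.
(* The degree 4 Hermite polynomial equals -2 at 1, so its contribution [- s k] cancels the [s k]
   inside [d]. This cancellation dictates the coefficient [s]. *)
have -> : ((1 + d) ^+ 2 - 1) / 2 +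
    s / 2 * k * ((1 + d) ^+ 4 - 6 * (1 + d) ^+ 2 + 3) - t * M * k ^+ 2 =
    d ^+ 2 / 2 + s * k * (- (4 * d) + 2 * d ^+ 3 + d ^+ 4 / 2).
  by rewrite /d; field.
have sk : `|s * k| <= k / 3 by rewrite ger0_norm; nra.
have h3 : `|- (4 * d) + 2 * d ^+ 3 + d ^+ 4 / 2| <= 13 / 2 * k.
  move: dk (dd 2%N) (dd 3%N); rewrite !ler_norml.
  by move=> /andP[? ?] /andP[? ?] /andP[? ?]; apply/andP; split; lra.
have h4 : `|s * k * (- (4 * d) + 2 * d ^+ 3 + d ^+ 4 / 2)| <= 13 / 6 * k ^+ 2.
  have -> : 13 / 6 * k ^+ 2 = k / 3 * (13 / 2 * k) by field.
  by rewrite normrM ler_pM.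
apply: le_trans (ler_normD _ _) _; rewrite normrM normfV normr_nat.
have := sqr_ge0 k; lra.
Qed.

Lemma cstar_expansion : exists M delta : R, 0 < M /\ 0 < delta /\
  forall kappa, 0 < kappa < delta ->
    `|cstar kappa eps - (1 + (1 + eps ^+ 2) / 6 * kappa ^+ 2)| <= M * kappa ^+ 4.
Proof.
have /andP[e0 e1] := heps; have E0 := expR_gt0 (4 : R).
(* The 3 pays for the error in [cstar_equation_bracket]; the other term is the remainder constant
   [256 * expR 4] divided by [4 * eps]. *)
pose M := 3 + 64 * expR 4 / eps.
have M3 : 3 <= M by rewrite lerDl divr_ge0 ?mulr_ge0 // ltW.
exists M, (2 * M)^-1; split; first by lra.
split; first by rewrite invr_gt0; lra.
move=> kappa /andP[k0 kM].
have k2M : M * kappa <= 1 / 2.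
  by move: kM; rewrite -[_^-1]mul1r ltr_pdivlMr; lra.
have k6 : kappa <= 1 / 6 by nra.
pose k := kappa ^+ 2; pose s := (1 + eps ^+ 2) / 6.
have k01 : 0 < k <= 1 by rewrite /k; apply/andP; split; [rewrite exprn_gt0|nra].
have s01 : 0 <= s <= 1 / 3 by rewrite /s; apply/andP; split; nra.
have Mk : M * k <= 1 / 2 by rewrite /k; nra.
have M0 : 0 <= M by lra.
pose c t := 1 + s * k + t * M * k ^+ 2.
pose F x := mix_ratio (upper_radius kappa eps) x -
            mix_ratio (lower_radius kappa eps) x.
have FE t : `|t| <= 1 -> `|F (c t) - 4 * eps * (t * M * k ^+ 3)|
    <= 4 * eps * (M * k ^+ 3).
  move=> t1; have [c2 hb] := cstar_equation_bracket k s t M k01 s01 t1 M0 Mk.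
  have k12 : 0 < kappa <= 1 / 2 by apply/andP; split; lra.
  have := mix_ratio_diff_taylor kappa (c t) k12 c2.
  move: hb; rewrite -/(F _) -/(c t) -/k (_ : (1 + eps ^+ 2) / 12 = s / 2);
    last by rewrite /s; field.
  have -> : kappa ^+ 6 = k ^+ 3 by rewrite /k -exprM.
  have /andP[kk0 _] := k01.
  move: (_ / 2 + _) => br hbr hF.
  have h : `|4 * eps * k * (br - t * M * k ^+ 2)| <= 4 * eps * (3 * k ^+ 3).
    have -> : 4 * eps * (3 * k ^+ 3) = 4 * eps * k * (3 * k ^+ 2) by ring.
    by rewrite normrM gtr0_norm ?ler_wpM2l // ?mulr_ge0 ?mulr_gt0 //; lra.
  have -> : M = 3 + 64 * expR 4 / eps by [].
  rewrite (_ : F (c t) - _ = (F (c t) - 4 * eps * k * br) +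
    4 * eps * k * (br - t * M * k ^+ 2)); last by rewrite /M; ring.
  apply: le_trans (ler_normD _ _) _.
  rewrite (_ : 4 * eps * ((3 + 64 * expR 4 / eps) * k ^+ 3) =
    256 * expR 4 * k ^+ 3 + 4 * eps * (3 * k ^+ 3)).
    exact: lerD.
  by field; rewrite gt_eqF.
have cm : c (-1) <= c 1.
  by rewrite /c; have := sqr_ge0 k; nra.
have Fm : F (c (- 1)) <= 0.
  by have := FE (- 1); rewrite normrN1 ler_norml => /(_ (lexx _)) /andP[_]; lra.
have Fp : 0 <= F (c 1).
  by have := FE 1; rewrite normr1 ler_norml => /(_ (lexx _)) /andP[+ _]; lra.
have cF : continuous F.
  by move=> x; apply: cvgB; exact: continuous_mix_ratio.
have [|x xc Fx] := @IVT R F (c (- 1)) (c 1) 0 cm (continuous_subspaceT cF).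
  by rewrite ge_min le_max Fm Fp orbT.
move: xc; rewrite in_itv /= => /andP[x1 x2].
have kk : k ^+ 2 = kappa ^+ 4 by rewrite /k -exprM.
(* [M * k <= 1/2] and [k <= 1] keep [c (-1)] at or above [1/2]. *)
have x0 : 0 < x.
  apply: lt_le_trans x1; rewrite /c.
  have /andP[? ?] := k01; have /andP[? ?] := s01; nra.
rewrite (cstar_solution kappa x) //.
  rewrite -kk -/k -/s ler_norml; move: x1 x2; rewrite /c => x1 x2.
  by apply/andP; split; lra.
by apply/eqP; rewrite -subr_eq0; apply/eqP.
Qed.

End cstar_expansion.

(** * Integrals against normal laws and over the rejection region *)

Section integration.
Variable R : realType.
Local Notation mu := (@lebesgue_measure R).
Local Open Scope ereal_scope.

(** Change of variables produces the Radon-Nikodym derivative; it agrees almost everywhere with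
    [normal_pdf] because both have the same integral over every measurable set. *)
Lemma integral_normal_prob (m s : R) (f : R -> R) :
  measurable_fun setT f -> (forall x, (0 <= f x)%R) ->
  \int[normal_prob m s]_x (f x)%:E = \int[mu]_x (f x * normal_pdf m s x)%:E.
Proof.
move=> /measurable_EFinP mf f0.
under [RHS]eq_integral do rewrite EFinM.
have dom := normal_prob_dominates m s.
rewrite -(Radon_Nikodym_SigmaFinite.change_of_variables dom) //.
have mRN := measurable_int _ (Radon_Nikodym_SigmaFinite.f_integrable dom).
have mpdf : measurable_fun setT (fun x => (normal_pdf m s x)%:E).
  by apply/measurable_EFinP; exact: measurable_normal_pdf.
apply: ae_eq_integral => //; [exact: emeasurable_funM..|].
apply: ae_eqe_mul2l; apply: integral_ae_eq => //.
  exact: Radon_Nikodym_SigmaFinite.f_integrable.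
by move=> E _ mE; rewrite -Radon_Nikodym_SigmaFinite.f_integral.
Qed.

Lemma outerE : [set y : R | (1 <= `|y|)%R] = `]-oo, (- 1)%R] `|` `[1%R, +oo[.
Proof.
apply/seteqP; split => y /=; rewrite !in_itv /= andbT ler_normr lerNr.
  by move=> /orP[]; [right|left].
by move=> [->|->]; rewrite ?orbT.
Qed.

Lemma ge0_integral_outer (f : R -> R) : continuous f -> (forall x, (0 <= f x)%R) ->
  \int[mu]_(x in [set y | (1 <= `|y|)%R]) (f x)%:E =
  \int[mu]_(x in `[1%R, +oo[) (f x + f (- x))%:E.
Proof.
move=> cf f0.
have mf (D : set R) : measurable_fun D (fun x : R => (f x)%:E).
  by apply/measurable_EFinP; apply: measurable_funTS; exact: continuous_measurable_fun.
have mfN (D : set R) : measurable_fun D (fun x : R => (f (- x))%:E).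
  apply/measurable_EFinP; apply: measurable_funTS; apply: continuous_measurable_fun.
  move=> x; apply: (continuous_comp (f := -%R)); last exact: cf.
  exact: opp_continuous.
rewrite outerE.
rewrite ge0_integral_setU //; last 3 first.
- exact: mf.
- by move=> x _; rewrite lee_fin.
- rewrite disj_set2E; apply/eqP; rewrite -subset0 => y [] /=.
  by rewrite !in_itv /= andbT => ? ?; lra.
under [RHS]eq_integral do rewrite EFinD.
rewrite ge0_integralD //; try by move=> x _; rewrite lee_fin.
rewrite addeC; congr (_ + _).
rewrite ge0_integration_by_substitutionNy //.
- exact: continuous_subspaceT.
- exact: mf.
- exact: mfN.
Qed.

End integration.

(** * The symmetric two-point mixture and the power of the test rejecting for [|y| >= 1] *)

(** The product form lets the bounds on [mix_ratio] apply directly; [mix_pdfE] recovers the average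
    of the two normal densities. *)
Definition mix_pdf {R : realType} (m y : R) : R := normal_pdf 0 1 y * mix_ratio m y.

Section mixture.
Variable R : realType.
Implicit Types m y a b : R.
Local Notation mu := (@lebesgue_measure R).
Local Notation outer := [set y : R | (1 <= `|y|)].

Lemma normal_pdf_std y : normal_pdf 0 1 y = normal_pdf 0 1 0 * expR (- (y ^+ 2 / 2)).
Proof.
rewrite normal_pdfE ?oner_neq0 // /normal_fun !subr0 expr1n.
by rewrite expr0n /= oppr0 mul0r expR0 mulr1 mulNr.
Qed.

Lemma normal_pdf_tilt m y :
  normal_pdf m 1 y = normal_pdf 0 1 y * expR (m * y - m ^+ 2 / 2).
Proof.
rewrite normal_pdfE ?oner_neq0 // normal_pdfE ?oner_neq0 // -mulrA -expRD.
by congr (_ * expR _); rewrite expr1n; field.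
Qed.

Lemma normal_pdf_gt0 m y : 0 < normal_pdf m 1 y.
Proof.
by rewrite normal_pdfE ?oner_neq0 // mulr_gt0 ?expR_gt0 // normal_peak_gt0 // oner_neq0.
Qed.

Lemma normal_pdf_even y : normal_pdf 0 1 (- y) = normal_pdf 0 1 y.
Proof. by rewrite normal_pdf_std sqrrN -normal_pdf_std. Qed.

Lemma mix_pdfE m y : mix_pdf m y = (normal_pdf m 1 y + normal_pdf (- m) 1 y) / 2.
Proof.
rewrite (normal_pdf_tilt m) (normal_pdf_tilt (- m)).
rewrite /mix_pdf /mix_ratio /cosh sqrrN mulNr !expRD.
by field.
Qed.

Lemma mix_pdf_ge0 m y : 0 <= mix_pdf m y.
Proof. by rewrite mulr_ge0 ?normal_pdf_ge0 // ltW // mix_ratio_gt0. Qed.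

Lemma mix_pdfNr m y : mix_pdf m (- y) = mix_pdf m y.
Proof. by rewrite /mix_pdf normal_pdf_even mix_ratioNr. Qed.

Lemma mix_pdfNl m y : mix_pdf (- m) y = mix_pdf m y.
Proof. by rewrite /mix_pdf mix_ratioNl. Qed.

Lemma continuous_mix_pdf m : continuous (mix_pdf m).
Proof.
move=> y; apply: cvgM; first exact: continuous_normal_pdf (oner_neq0 _) _.
exact: continuous_mix_ratio.
Qed.

Lemma measurable_mix_pdf m : measurable_fun setT (mix_pdf m).
Proof. by apply: continuous_measurable_fun; exact: continuous_mix_pdf. Qed.

Local Open Scope ereal_scope.

Lemma integral_mix_pdf_setT m : \int[mu]_x (mix_pdf m x)%:E = 1.
Proof.
under eq_integral do rewrite mix_pdfE mulrC EFinM EFinD.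
rewrite ge0_integralZl_EFin ?invr_ge0 //; last 2 first.
- by move=> x _; rewrite -EFinD lee_fin addr_ge0 // normal_pdf_ge0.
- by apply: emeasurable_funD; apply/measurable_EFinP; exact: measurable_normal_pdf.
rewrite ge0_integralD //; try (by move=> x _; rewrite lee_fin normal_pdf_ge0);
  try (by apply/measurable_EFinP; exact: measurable_normal_pdf).
by rewrite !integral_normal_pdf -EFinD -EFinM mulVf.
Qed.

Lemma measurable_outer : measurable outer.
Proof.
by rewrite outerE; exact: measurableU.
Qed.

(** The region is symmetric, so the laws centred at [m] and [- m] give it the same mass, which is
    also that of their mixture. *)
Lemma normal_prob_outer m :
  normal_prob m 1 outer = \int[mu]_(x in outer) (mix_pdf m x)%:E.
Proof.
rewrite /normal_prob !ge0_integral_outer //.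
- apply: eq_integral => x _; congr EFin.
  rewrite mix_pdfNr -mulr2n -mulr_natr mix_pdfE mulfVK ?pnatr_eq0 //.
  congr (_ + _)%R; rewrite normal_pdf_tilt normal_pdf_even.
  by rewrite [RHS]normal_pdf_tilt sqrrN mulrN mulNr.
- exact: continuous_mix_pdf.
- by move=> x; exact: mix_pdf_ge0.
- exact: continuous_normal_pdf (oner_neq0 _).
- by move=> x; exact: normal_pdf_ge0.
Qed.

Lemma integral_mix_pdf_outerC m :
  \int[mu]_(x in outer) (mix_pdf m x)%:E
  + \int[mu]_(x in ~` outer) (mix_pdf m x)%:E = 1.
Proof.
rewrite -ge0_integral_setU //.
- by rewrite setUv integral_mix_pdf_setT.
- exact: measurable_outer.
- exact: measurableC measurable_outer.
- by apply/measurable_EFinP/measurable_funTS; exact: measurable_mix_pdf.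
- by move=> x _; rewrite lee_fin mix_pdf_ge0.
- by rewrite disj_set2E setICr.
Qed.

(* The likelihood ratio is monotone in [|y|]: either it is at least 1 on the
   whole of [|y| >= 1], or it is at most 1 on the whole complement. *)
Lemma normal_prob_outer_le m a : (`|m| <= a)%R ->
  normal_prob m 1 outer <= normal_prob a 1 outer.
Proof.
move=> ma.
have mm (D : set R) c : measurable_fun D (EFin \o mix_pdf c).
  by apply/measurable_EFinP/measurable_funTS; exact: measurable_mix_pdf.
have [h|h] := leP (mix_ratio m 1) (mix_ratio a 1).
  rewrite !normal_prob_outer; apply: ge0_le_integral => //.
  - exact: measurable_outer.
  - by move=> x _; rewrite lee_fin mix_pdf_ge0.
  - exact: mm.
  - exact: mm.
  move=> x /= x1; rewrite lee_fin ler_wpM2l ?normal_pdf_ge0 //.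
  by apply: mix_ratio_dominated ma _ h; rewrite normr1.
(* In this case the ratio favours [m] at 1. If it favoured [a] at some [|x| < 1], domination would
   carry this out to 1, a contradiction. The comparison on the complement is then turned around
   using total mass 1. *)
have hC : \int[mu]_(x in ~` outer) (mix_pdf a x)%:E <=
          \int[mu]_(x in ~` outer) (mix_pdf m x)%:E.
  apply: ge0_le_integral => //.
  - exact: measurableC measurable_outer.
  - by move=> x _; rewrite lee_fin mix_pdf_ge0.
  - exact: mm.
  - exact: mm.
  move=> x /= /negP; rewrite -ltNge => x1.
  rewrite lee_fin ler_wpM2l ?normal_pdf_ge0 // leNgt; apply/negP => /ltW hx.
  have := mix_ratio_dominated _ _ _ x 1%R ma _ hx.
  by rewrite normr1 => /(_ (ltW x1)); rewrite leNgt h.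
rewrite !normal_prob_outer.
have fin c D : measurable D -> \int[mu]_(x in D) (mix_pdf c x)%:E \is a fin_num.
  move=> mD; rewrite ge0_fin_numE; last first.
    by apply: integral_ge0 => x _; rewrite lee_fin mix_pdf_ge0.
  apply: (@le_lt_trans _ _ 1); last by rewrite ltry.
  rewrite -(integral_mix_pdf_setT c); apply: ge0_subset_integral => //.
  - exact: mm.
  - by move=> x _; rewrite lee_fin mix_pdf_ge0.
have mO := measurable_outer; have mC := measurableC mO.
have compl (u u' v v' : \bar R) : u \is a fin_num -> u' \is a fin_num ->
    v \is a fin_num -> v' \is a fin_num ->
    u + u' = 1 -> v + v' = 1 -> v' <= u' -> u <= v.
  move: u u' v v' => [u| |] [u'| |] [v| |] [v'| |] // _ _ _ _ [] Em [] Ea.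
  by rewrite !lee_fin; lra.
exact: (compl _ _ _ _ (fin _ _ mO) (fin _ _ mC) (fin _ _ mO) (fin _ _ mC)
  (integral_mix_pdf_outerC m) (integral_mix_pdf_outerC a) hC).
Qed.

Lemma cvg_id_normal_pdf : (x * normal_pdf 0 1 x : R)%R @[x --> +oo%R] --> 0%R.
Proof.
have p0 := normal_pdf_gt0 0 0.
(* [expR (x^2 / 2) >= x^2 / 2] gives the upper bound, of order [1 / x]. *)
apply: (@squeeze_cvgr _ _ _ _ (cst 0%R) (fun x => 2 * normal_pdf 0 1 0 * x^-1)%R).
- near=> x.
  have x0 : (0 < x)%R by near: x; exact: nbhs_pinfty_gt.
  rewrite /= mulr_ge0 ?(ltW x0) ?normal_pdf_ge0 //=.
  rewrite ler_pdivlMr // (normal_pdf_std x) expRN.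
  have e0 := expR_gt0 (x ^+ 2 / 2).
  have : (x ^+ 2 / 2 <= expR (x ^+ 2 / 2))%R.
    by apply: le_trans (expR_ge1Dx _); rewrite lerDr.
  move: (expR _) e0 => e e0 he.
  rewrite (_ : _ * x = normal_pdf 0 1 0 * (x ^+ 2 / e))%R; last by ring.
  by rewrite [leRHS]mulrC ler_pM2l // ler_pdivrMr //; lra.
- exact: cvg_cst.
- have V0 : (x^-1 : R)%R @[x --> +oo%R] --> (0%R : R).
    apply/gtr0_cvgV0; last exact: cvg_id.
    by near=> x; near: x; exact: nbhs_pinfty_gt.
  have := cvgM (cvg_cst (2 * normal_pdf 0 1 0)%R) V0.
  by rewrite mulr0; apply.
Unshelve. all: by end_near. Qed.

(* [- y phi(y)] is an antiderivative of [(y^2 - 1) phi(y)]. *)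
Lemma integral_hermite2 :
  \int[mu]_(x in `[1%R, +oo[) ((x ^+ 2 - 1) * normal_pdf 0 1 x)%:E =
  (normal_pdf 0 1 1)%:E.
Proof.
pose F x : R := (- (x * normal_pdf 0 1 x))%R.
have dF (x : R) : is_derive x 1%R F ((x ^+ 2 - 1) * normal_pdf 0 1 x)%R.
  rewrite /F; under eq_fun do rewrite normal_pdf_std.
  rewrite (normal_pdf_std x); apply: is_derive_eq.
  by rewrite /GRing.scale /=; field.
rewrite (@ge0_continuous_FTC2y _ _ F 1%R 0%R).
- by rewrite /F mul1r sub0e -EFinN opprK.
- move=> x x1; rewrite mulr_ge0 ?normal_pdf_ge0 // subr_ge0.
  by rewrite expr_ge1 //; lra.
- apply: continuous_subspaceT => x; apply: cvgM.
    by apply: cvgB; [exact: exprn_continuous|exact: cvg_cst].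
  exact: continuous_normal_pdf (oner_neq0 _) _.
- by rewrite -oppr0; apply: cvgN; exact: cvg_id_normal_pdf.
- by move=> x _; exact: (@ex_derive _ _ _ _ _ _ _ (dF x)).
- apply: cvg_at_right_filter; apply: differentiable_continuous.
  by apply/derivable1_diffP; exact: (@ex_derive _ _ _ _ _ _ _ (dF _)).
- by move=> x _; rewrite derive1E; exact: (@derive_val _ _ _ _ _ _ _ (dF x)).
Qed.

End mixture.

(** * Matching lower and upper bounds on the minimax risk *)

Section risk.
Variable R : realType.
Implicit Types m y a b kappa eps : R.
Local Notation mu := (@lebesgue_measure R).
Local Notation outer := [set y : R | (1 <= `|y|)].

(** The positive part keeps the integrand nonnegative on the whole line, as the integration lemmas
    for nonnegative functions require. *)
Definition hermite2_pos y : R := Num.max 0 (y ^+ 2 - 1) * normal_pdf 0 1 y.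

Lemma hermite2_pos_ge0 y : 0 <= hermite2_pos y.
Proof. by rewrite mulr_ge0 ?normal_pdf_ge0 // le_max lexx. Qed.

Lemma continuous_hermite2_pos : continuous hermite2_pos.
Proof.
move=> y; apply: cvgM; last exact: continuous_normal_pdf (oner_neq0 _) _.
apply: (continuous_max (f := fun=> 0) (g := fun y => y ^+ 2 - 1)).
  exact: cvg_cst.
by apply: cvgB; [exact: exprn_continuous|exact: cvg_cst].
Qed.

Lemma hermite2_pos_outer y : 1 <= `|y| ->
  hermite2_pos y = (y ^+ 2 - 1) * normal_pdf 0 1 y.
Proof.
move=> y1; rewrite /hermite2_pos max_r // subr_ge0 -[y ^+ 2]ger0_norm ?sqr_ge0 //.
by rewrite normrX expr_ge1.
Qed.

Lemma hermite2_pos_inner y : `|y| < 1 -> hermite2_pos y = 0.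
Proof.
move=> y1; rewrite /hermite2_pos max_l ?mul0r // subr_le0.
by rewrite -[y ^+ 2]ger0_norm ?sqr_ge0 // normrX exprn_ile1 // ltW.
Qed.

(** The constant is [8 * 2^4 + 8 * 1], from [1 + eps <= 2] and [1 - eps <= 1]; [expR 2] undoes the
    normalising factor of [mix_ratio 2]. *)
Lemma mix_pdf_diff_taylor kappa eps y : 0 < kappa <= 1 / 2 -> 0 < eps < 1 ->
  `|mix_pdf (upper_radius kappa eps) y - mix_pdf (lower_radius kappa eps) y
    - 2 * eps * kappa ^+ 2 * ((y ^+ 2 - 1) * normal_pdf 0 1 y)|
  <= 136 * expR 2 * kappa ^+ 4 * mix_pdf 2 y.
Proof.
move=> /andP[k0 k1] /andP[e0 e1]; rewrite /lower_radius /upper_radius.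
have hb : `|(1 + eps) * kappa| <= 1 by rewrite ler_norml; apply/andP; split; nra.
have ha : `|(1 - eps) * kappa| <= 1 by rewrite ler_norml; apply/andP; split; nra.
have := mix_ratio_taylor4 _ _ y hb; have := mix_ratio_taylor4 _ _ y ha.
have c0 := cosh_gt0 _ (2 * y).
have k40 : 0 <= kappa ^+ 4 by rewrite exprn_ge0 // ltW.
have kc0 : 0 <= kappa ^+ 4 * cosh (2 * y) by rewrite mulr_ge0 // ltW.
have hB : 8 * ((1 + eps) * kappa) ^+ 4 * cosh (2 * y) <=
    128 * (kappa ^+ 4 * cosh (2 * y)).
  rewrite exprMn.
  have : (1 + eps) ^+ 4 <= 16.
    by rewrite (_ : 16 = 2 ^+ 4 :> R) ?lerXn2r ?nnegrE //; [lra|lra|ring].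
  by move: (_ ^+ 4) => E ?; nra.
have hA : 8 * ((1 - eps) * kappa) ^+ 4 * cosh (2 * y) <=
    8 * (kappa ^+ 4 * cosh (2 * y)).
  rewrite exprMn.
  have : (1 - eps) ^+ 4 <= 1 by apply: exprn_ile1; lra.
  by move: (_ ^+ 4) => E ?; nra.
have mE : 136 * expR 2 * kappa ^+ 4 * mix_pdf 2 y =
    normal_pdf 0 1 y * (136 * (kappa ^+ 4 * cosh (2 * y))).
  rewrite /mix_pdf /mix_ratio (_ : 2 ^+ 2 / 2 = 2 :> R); last by field.
  by rewrite expRN; field; rewrite gt_eqF // expR_gt0.
move=> /le_trans - /(_ _ hA) ta /le_trans - /(_ _ hB) tb.
rewrite mE /mix_pdf.
rewrite (_ : _ - _ - _ = normal_pdf 0 1 y *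
  (mix_ratio ((1 + eps) * kappa) y - mix_ratio ((1 - eps) * kappa) y
    - 2 * eps * kappa ^+ 2 * (y ^+ 2 - 1))); last by ring.
rewrite normrM ger0_norm ?normal_pdf_ge0 // ler_wpM2l ?normal_pdf_ge0 //.
move: ta tb; rewrite !ler_norml => /andP[a1 a2] /andP[b1 b2].
by apply/andP; split; lra.
Qed.

Local Open Scope ereal_scope.

Lemma measurable_hermite2_pos (D : set R) :
  measurable_fun D (EFin \o hermite2_pos).
Proof.
apply/measurable_EFinP/measurable_funTS; apply: continuous_measurable_fun.
exact: continuous_hermite2_pos.
Qed.

Lemma integral_hermite2_pos_outer :
  \int[mu]_(x in outer) (hermite2_pos x)%:E = (2 * normal_pdf 0 1 1)%:E.
Proof.
rewrite ge0_integral_outer; [|exact: continuous_hermite2_pos|exact: hermite2_pos_ge0].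
rewrite EFinM -[X in _ = _ * X]integral_hermite2 -ge0_integralZl_EFin; last 4 first.
- by [].
- move=> x /=; rewrite in_itv /= andbT => x1.
  by rewrite lee_fin mulr_ge0 ?normal_pdf_ge0 // subr_ge0 expr_ge1 //; lra.
- apply/measurable_EFinP/measurable_funTS; apply: measurable_funM => //.
    by apply: measurable_funB => //; exact: measurable_funX.
  exact: measurable_normal_pdf.
- by [].
apply: eq_integral => x; rewrite inE /= in_itv /= andbT => x1.
rewrite {2}/hermite2_pos sqrrN normal_pdf_even -/(hermite2_pos x).
rewrite hermite2_pos_outer; last by rewrite ger0_norm //; lra.
by rewrite -EFinM; congr EFin; ring.
Qed.

(** The positive part vanishes for [|y| < 1]. Hence the lower bound, integrated over the line, and
    the upper bound, integrated over the rejection region, share their leading constant. *)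
Lemma integral_hermite2_pos :
  \int[mu]_x (hermite2_pos x)%:E = (2 * normal_pdf 0 1 1)%:E.
Proof.
rewrite -integral_hermite2_pos_outer [RHS]integral_mkcond.
apply: eq_integral => x _; rewrite patchE; case: ifPn => // /negP.
by rewrite inE /= => /negP; rewrite -ltNge => /hermite2_pos_inner ->.
Qed.

Lemma expectation_mix m (f : R -> R) :
  measurable_fun setT f -> (forall x, (0 <= f x)%R) ->
  'E_(normal_prob m 1)[f] + 'E_(normal_prob (- m) 1)[f] =
  2%:E * \int[mu]_x (f x * mix_pdf m x)%:E.
Proof.
move=> mf f0; rewrite unlock !(integral_normal_prob _ _ _ _ mf f0).
have mn c : measurable_fun setT (fun x => (f x * normal_pdf c 1 x)%:E).
  by apply/measurable_EFinP/measurable_funM => //; exact: measurable_normal_pdf.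
rewrite -ge0_integralD //;
  try (by move=> x _; rewrite lee_fin mulr_ge0 ?normal_pdf_ge0); try exact: mn.
rewrite -ge0_integralZl_EFin //; last 2 first.
- by move=> x _; rewrite lee_fin mulr_ge0 ?mix_pdf_ge0.
- by apply/measurable_EFinP/measurable_funM => //; exact: measurable_mix_pdf.
apply: eq_integral => x _; rewrite -EFinD -EFinM mix_pdfE; congr EFin.
by field.
Qed.

(** A supremum is at least the average over the two-point prior at [m] and [- m]. *)
Lemma sup_expectation_ge (M : set R) m (f : R -> R) :
  measurable_fun setT f -> (forall x, (0 <= f x)%R) -> M m -> M (- m)%R ->
  \int[mu]_x (f x * mix_pdf m x)%:E <=
  ereal_sup [set 'E_(normal_prob c 1)[f] | c in M].
Proof.
move=> mf f0 Mm MNm.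
have h1 : 'E_(normal_prob m 1)[f] <= ereal_sup [set 'E_(normal_prob c 1)[f] | c in M].
  by apply: ereal_sup_ubound; exists m.
have h2 : 'E_(normal_prob (- m) 1)[f] <=
    ereal_sup [set 'E_(normal_prob c 1)[f] | c in M].
  by apply: ereal_sup_ubound; exists (- m)%R.
have := leeD h1 h2; rewrite expectation_mix //.
rewrite -[X in _ <= X]mule2n -mule_natl.
by rewrite lee_pmul2l.
Qed.

Lemma sum_of_errors_ge kappa eps phi : (0 < kappa <= 1 / 2)%R ->
  (0 < eps < 1)%R -> randomized_test phi ->
  (1 - (4 * eps * normal_pdf 0 1 1 * kappa ^+ 2 + 136 * expR 2 * kappa ^+ 4))%:E
  <= sum_of_errors kappa eps phi.
Proof.
move=> k e [mphi phi01]; have /andP[k0 k1] := k; have /andP[e0 e1] := e.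
have phi0 x : (0 <= phi x)%R by have /andP[] := phi01 x.
have phi1 x : (0 <= 1 - phi x)%R by have /andP[] := phi01 x; rewrite subr_ge0.
set a := lower_radius kappa eps; set b := upper_radius kappa eps.
have a0 : (0 <= a)%R by rewrite /a /lower_radius; nra.
have b0 : (0 <= b)%R by rewrite /b /upper_radius; nra.
set r := (4 * eps * _ * _ + _)%R.
pose p : R := (2 * eps * kappa ^+ 2)%R; pose N : R := (136 * expR 2 * kappa ^+ 4)%R.
have p0 : (0 <= p)%R by rewrite mulr_ge0 ?mulr_ge0 ?sqr_ge0 // ltW.
have N0 : (0 <= N)%R by rewrite /N !mulr_ge0 ?expR_ge0 ?exprn_ge0 ?(ltW k0).
have mphi1 : measurable_fun setT (fun y : R => 1 - phi y)%R.
  exact: measurable_funB.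
have hA := sup_expectation_ge [set c : R | `|c| <= a]%R a phi mphi phi0.
have hB := sup_expectation_ge [set c : R | b <= `|c|]%R b _ mphi1 phi1.
rewrite /sum_of_errors -/a -/b.
apply: (@le_trans _ _ (\int[mu]_x (phi x * mix_pdf a x)%:E +
    \int[mu]_x ((1 - phi x) * mix_pdf b x)%:E)); last first.
  by apply: leeD; [apply: hA|apply: hB]; rewrite /= ?normrN ger0_norm.
have mD : measurable_fun setT (fun x : R => (p * hermite2_pos x)%:E).
  apply/measurable_EFinP/measurable_funM => //.
  by have /measurable_EFinP := measurable_hermite2_pos setT.
have mM c : measurable_fun setT (fun x : R => (c * mix_pdf 2 x)%:E).
  by apply/measurable_EFinP/measurable_funM => //; exact: measurable_mix_pdf.
have mP c (g : R -> R) : measurable_fun setT g ->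
    measurable_fun setT (fun x : R => (g x * mix_pdf c x)%:E).
  by move=> mg; apply/measurable_EFinP/measurable_funM => //; exact: measurable_mix_pdf.
have rE : r%:E = \int[mu]_x (p * hermite2_pos x)%:E + \int[mu]_x (N * mix_pdf 2 x)%:E.
  under eq_integral do rewrite EFinM.
  rewrite ge0_integralZl_EFin //; last 2 first.
  - by move=> x _; rewrite lee_fin hermite2_pos_ge0.
  - exact: measurable_hermite2_pos.
  under [X in _ + X]eq_integral do rewrite EFinM.
  rewrite ge0_integralZl_EFin //; last 2 first.
  - by move=> x _; rewrite lee_fin mix_pdf_ge0.
  - by apply/measurable_EFinP; exact: measurable_mix_pdf.
  rewrite integral_hermite2_pos integral_mix_pdf_setT mule1 -EFinM -EFinD.
  by congr EFin; rewrite /r /p /N; ring.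
(* The subtraction is moved across so that only nonnegative integrands remain; the 1 is then written
   as the integral of [mix_pdf b], and the claim becomes pointwise. *)
rewrite EFinB leeBlDr // rE.
have g1 x : (0 <= phi x * mix_pdf a x)%R by rewrite mulr_ge0 ?mix_pdf_ge0.
have g2 x : (0 <= (1 - phi x) * mix_pdf b x)%R by rewrite mulr_ge0 ?mix_pdf_ge0.
have g3 x : (0 <= p * hermite2_pos x)%R by rewrite mulr_ge0 ?hermite2_pos_ge0.
have g4 x : (0 <= N * mix_pdf 2 x)%R by rewrite mulr_ge0 ?mix_pdf_ge0.
rewrite -ge0_integralD //; [|by move=> *; rewrite lee_fin|exact: mP
  |by move=> *; rewrite lee_fin|exact: mP].
rewrite -[X in _ <= _ + X]ge0_integralD //;
  try (by move=> *; rewrite lee_fin); try by [exact: mD|exact: mM].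
rewrite -ge0_integralD //; last 4 first.
- by move=> x _; rewrite -EFinD lee_fin addr_ge0.
- by apply: emeasurable_funD; exact: mP.
- by move=> x _; rewrite -EFinD lee_fin addr_ge0.
- by apply: emeasurable_funD; [exact: mD|exact: mM].
rewrite -(integral_mix_pdf_setT _ b); apply: ge0_le_integral => //.
- by move=> x _; rewrite lee_fin mix_pdf_ge0.
- by apply/measurable_EFinP; exact: measurable_mix_pdf.
- apply: emeasurable_funD; apply: emeasurable_funD;
    by [exact: mP|exact: mD|exact: mM].
move=> x _; rewrite -!EFinD lee_fin.
have hT := mix_pdf_diff_taylor kappa eps x k e.
have step : (mix_pdf b x - mix_pdf a x <= p * hermite2_pos x + N * mix_pdf 2 x)%R.
  move: hT; rewrite ler_norml -/a -/b -/p -/N => /andP[_ hT].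
  apply: (@le_trans _ _ (p * ((x ^+ 2 - 1) * normal_pdf 0 1 x) + N * mix_pdf 2 x)%R).
    lra.
  rewrite lerD2r ler_wpM2l // ler_wpM2r ?normal_pdf_ge0 //.
  by rewrite le_max lexx orbT.
have D0 : (0 <= p * hermite2_pos x + N * mix_pdf 2 x)%R by rewrite addr_ge0.
have fx := phi0 x; have fx1 := phi1 x.
set C := (p * hermite2_pos x + N * mix_pdf 2 x)%R in step D0 *.
(* It remains to see [phi * (mix_pdf b - mix_pdf a) <= C], which follows from [0 <= phi <= 1] and
   [C >= 0]. *)
have h1 : (phi x * (mix_pdf b x - mix_pdf a x) <= phi x * C)%R by rewrite ler_wpM2l.
have h2 : (0 <= (1 - phi x) * C)%R by rewrite mulr_ge0.
lra.
Qed.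

Lemma normal_prob_outer_norm m : normal_prob `|m| 1 outer = normal_prob m 1 outer.
Proof.
rewrite !normal_prob_outer; apply: eq_integral => x _.
by case: ger0P => // _; rewrite mix_pdfNl.
Qed.

(** Monotonicity of the rejection probability in the modulus of the mean bounds the two suprema by
    the values at [a] and [b]. *)
Lemma sum_of_errors_indic_le kappa eps : (0 < kappa <= 1 / 2)%R ->
  (0 < eps < 1)%R ->
  sum_of_errors kappa eps \1_outer <=
  (1 - 4 * eps * normal_pdf 0 1 1 * kappa ^+ 2 + 136 * expR 2 * kappa ^+ 4)%:E.
Proof.
move=> k e; have /andP[k0 k1] := k; have /andP[e0 e1] := e.
rewrite /sum_of_errors.
set a := lower_radius kappa eps; set b := upper_radius kappa eps.
have mO := measurable_outer R.
have mm (D : set R) c : measurable_fun D (EFin \o mix_pdf c).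
  by apply/measurable_EFinP/measurable_funTS; exact: measurable_mix_pdf.
have EC c : 'E_(normal_prob c 1)[(fun y : R => 1 - \1_outer y)%R] =
    1 - normal_prob c 1 outer.
  rewrite -probability_setC // -expectation_indic; last exact: measurableC.
  rewrite indicC (_ : (fun y : R => 1 - \1_outer y)%R =
    (fun y : R => (~~ (y \in outer))%:R)%R) //.
  by apply/funext => y; rewrite indicE; case: (_ \in _); rewrite ?subrr ?subr0.
have supA : ereal_sup [set 'E_(normal_prob c 1)[\1_outer] | c in
    [set c : R | `|c| <= a]%R] <= normal_prob a 1 outer.
  apply: ge_ereal_sup => _ [c /= ca <-]; rewrite expectation_indic //.
  exact: normal_prob_outer_le.
have supB : ereal_sup [set 'E_(normal_prob c 1)[(fun y : R => 1 - \1_outer y)%R] | c in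
    [set c : R | b <= `|c|]%R] <= 1 - normal_prob b 1 outer.
  apply: ge_ereal_sup => _ [c /= cb <-]; rewrite EC; apply: leeB; first exact: lexx.
  rewrite -(normal_prob_outer_norm c); apply: normal_prob_outer_le.
  by rewrite ger0_norm // /b /upper_radius; nra.
apply: le_trans (leeD supA supB) _.
pose p : R := (2 * eps * kappa ^+ 2)%R; pose N : R := (136 * expR 2 * kappa ^+ 4)%R.
have p0 : (0 <= p)%R by rewrite mulr_ge0 ?mulr_ge0 ?sqr_ge0 // ltW.
have N0 : (0 <= N)%R by rewrite /N !mulr_ge0 ?expR_ge0 ?exprn_ge0 ?(ltW k0).
(* The Taylor bound integrated over the region, arranged without subtraction; afterwards the mass of
   the region under [normal_prob 2 1] is bounded by 1. *)
have main : normal_prob a 1 outer + (p * (2 * normal_pdf 0 1 1))%:E <=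
    normal_prob b 1 outer + N%:E * normal_prob 2 1 outer.
  rewrite !normal_prob_outer EFinM -integral_hermite2_pos_outer.
  rewrite -!ge0_integralZl_EFin //; try exact: mm; try exact: measurable_hermite2_pos;
    try (by move=> x _; rewrite lee_fin ?mix_pdf_ge0 ?hermite2_pos_ge0).
  have m1 : measurable_fun outer (fun x : R => p%:E * (hermite2_pos x)%:E).
    by apply: measurable_funeM; exact: measurable_hermite2_pos.
  have m2 : measurable_fun outer (fun x : R => N%:E * (mix_pdf 2 x)%:E).
    by apply: measurable_funeM; exact: mm.
  have g1 (x : R) : 0 <= p%:E * (hermite2_pos x)%:E.
    by rewrite -EFinM lee_fin mulr_ge0 ?hermite2_pos_ge0.
  have g2 (x : R) : 0 <= N%:E * (mix_pdf 2 x)%:E.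
    by rewrite -EFinM lee_fin mulr_ge0 ?mix_pdf_ge0.
  have g3 c (x : R) : 0 <= (mix_pdf c x)%:E by rewrite lee_fin mix_pdf_ge0.
  rewrite -!ge0_integralD //; try exact: mm.
  apply: ge0_le_integral => //.
  - by move=> x _; rewrite adde_ge0.
  - by apply: emeasurable_funD => //; exact: mm.
  - by apply: emeasurable_funD => //; exact: mm.
  move=> x /= x1; rewrite -!EFinM -!EFinD lee_fin hermite2_pos_outer //.
  have := mix_pdf_diff_taylor kappa eps x k e.
  by rewrite ler_norml -/a -/b -/p -/N => /andP[h _]; lra.
move: main; rewrite /=.
have le1 : normal_prob 2 1 outer <= 1 by exact: probability_le1.
have fin c : normal_prob c 1 outer \is a fin_num by exact: fin_num_measure.
move: (normal_prob a 1 outer) (normal_prob b 1 outer) (normal_prob 2 1 outer)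
  (fin a) (fin b) (fin 2%R) le1 => [A| |] // [B| |] // [C| |] // _ _ _.
rewrite -EFinM -!EFinD !lee_fin => C1.
have NC : (N * C <= N)%R by rewrite ler_piMr.
by rewrite -/N /p => h; lra.
Qed.

Lemma minimax_risk_expansion kappa eps : (0 < kappa <= 1 / 2)%R ->
  (0 < eps < 1)%R ->
  (`|fine (minimax_risk kappa eps) - (1 - 4 * eps * normal_pdf 0 1 1 * kappa ^+ 2)|
   <= 136 * expR 2 * kappa ^+ 4)%R.
Proof.
move=> k e.
have lo : (1 - (4 * eps * normal_pdf 0 1 1 * kappa ^+ 2
    + 136 * expR 2 * kappa ^+ 4))%:E <= minimax_risk kappa eps.
  apply: le_ereal_inf_tmp => _ [phi hphi <-]; exact: sum_of_errors_ge.
have hi : minimax_risk kappa eps <=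
  (1 - 4 * eps * normal_pdf 0 1 1 * kappa ^+ 2 + 136 * expR 2 * kappa ^+ 4)%:E.
  apply: le_trans (sum_of_errors_indic_le _ _ k e).
  apply: ereal_inf_lbound; exists \1_outer => //; split.
    exact: measurable_indic (measurable_outer R).
  by move=> y; rewrite indicE; case: (_ \in _); rewrite /= ?lexx ?ler01.
(* The two real bounds exclude infinite values, so [fine] does not fall back on its default. *)
move: (minimax_risk kappa eps) lo hi => [v| |] //.
rewrite !lee_fin /= => lo hi.
by rewrite ler_norml; apply/andP; split; lra.
Qed.

End risk.

(** * Passage from explicit constants to the asymptotic statement *)

Theorem corollary1 (R : realType) (eps : R) (heps : 0 < eps < 1) :
  ((fun kappa : R => cstar kappa eps) =
     (fun kappa : R => 1 + (1 + eps ^+ 2) / 6 * kappa ^+ 2)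
     +O_ (0^'+) (fun kappa : R => kappa ^+ 4)) /\
  ((fun kappa : R => fine (minimax_risk kappa eps)) =
     (fun kappa : R => 1 - 4 * eps * normal_pdf 0 1 1 * kappa ^+ 2)
     +O_ (0^'+) (fun kappa : R => kappa ^+ 4)).
Proof.
split.
  have [M [delta [M0 [d0 hM]]]] := cstar_expansion R eps heps.
  apply/eqaddOP/bigO_exP; exists M => //; near=> kappa.
  have k0 : 0 < kappa by near: kappa; exact: nbhs_right_gt.
  rewrite [`|kappa ^+ 4|]ger0_norm ?exprn_ge0 ?(ltW k0) //.
  apply: hM; rewrite k0 /=; near: kappa; exact: nbhs_right_lt.
apply/eqaddOP/bigO_exP; exists (136 * expR 2); first by rewrite mulr_gt0 ?expR_gt0.
near=> kappa.
have k0 : 0 < kappa by near: kappa; exact: nbhs_right_gt.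
rewrite [`|kappa ^+ 4|]ger0_norm ?exprn_ge0 ?(ltW k0) //.
apply: minimax_risk_expansion => //; rewrite k0 /=; near: kappa.
by apply: nbhs_right_le.
Unshelve. all: by end_near. Qed.
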